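(* Let $n\ge2$. For every $m\in\mathbb{N}$, $\mathbb{Z}^m$ quasi-isometrically embeds into the Whitehead complex of $F_n$, i.e. into the quotient graph $\mathrm{Cay}(F_n,\mathrm{sep}_n)/\mathrm{Inn}(F_n)$.
   Context: An element of $F_n$ is separable if it lies in a proper free factor (a subgroup generated by a proper subset of a basis); $\mathrm{sep}_n$ is the set of separable elements. $\mathrm{Cay}(F_n,\mathrm{sep}_n)$ has vertex set $F_n$ and an undirected edge between $g$ and $sg$ for $s\in\mathrm{sep}_n$. $F_n$ acts on it by conjugation, and the quotient graph $\mathrm{Cay}(F_n,\mathrm{sep}_n)/\mathrm{Inn}(F_n)$ has vertices the conjugacy classes of $F_n$, two classes being adjacent iff they have adjacent representatives; it carries the path metric. $\mathbb Z^m$ has the $\ell^1$ metric. *)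

(* Defs.v *)
From Stdlib Require Import ZArith Reals.
From mathcomp Require Import all_boot.

Set Implicit Arguments.
Unset Strict Implicit.
Unset Printing Implicit Defensive.

(* A letter (i, false) stands for x_i, and (i, true) for x_i^{-1}. *)
Definition letter (n : nat) := ('I_n * bool)%type.

Definition linv n (a : letter n) : letter n := (a.1, ~~ a.2).

Fixpoint reduce n (w : seq (letter n)) : seq (letter n) :=
  match w with
  | [::] => [::]
  | a :: w' =>
      match reduce w' with
      | b :: r' => if b == linv a then r' else a :: b :: r'
      | [::] => [:: a]
      end
  end.

(* Elements of F_n are represented by reduced words. *)
Definition is_reduced n (w : seq (letter n)) : bool := reduce w == w.

Definition fmul n (u v : seq (letter n)) : seq (letter n) := reduce (u ++ v).
Definition finv n (w : seq (letter n)) : seq (letter n) := rev (map (@linv n) w).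

Definition fsubst n (b : 'I_n -> seq (letter n)) (w : seq (letter n))
  : seq (letter n) :=
  reduce (flatten (map (fun a : letter n =>
                          if a.2 then finv (b a.1) else b a.1) w)).

Definition is_basis n (b : 'I_n -> seq (letter n)) : Prop :=
  (forall i, is_reduced (b i)) /\
  (forall u v, is_reduced u -> is_reduced v -> fsubst b u = fsubst b v -> u = v) /\
  (forall g, is_reduced g -> exists2 w, is_reduced w & fsubst b w = g).

Definition in_span n (b : 'I_n -> seq (letter n)) (S : {set 'I_n})
  (g : seq (letter n)) : Prop :=
  exists w : seq (letter n), all (fun a : letter n => a.1 \in S) w /\ fsubst b w = g.

(* Separable elements: those lying in a proper free factor. *)
Definition separable n (g : seq (letter n)) : Prop :=
  is_reduced g /\
  exists b : 'I_n -> seq (letter n), exists S : {set 'I_n},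
    is_basis b /\ S != setT /\ in_span b S g.

Definition conjugate n (g h : seq (letter n)) : Prop :=
  exists2 x, is_reduced x & h = fmul (fmul (finv x) g) x.

(* Adjacency in Cay(F_n, sep_n)/Inn(F_n): the classes of g and h have
   representatives g', h' adjacent in Cay(F_n, sep_n). *)
Definition wh_adj n (g h : seq (letter n)) : Prop :=
  exists g' h' s, conjugate g g' /\ conjugate h h' /\ separable s /\
    (h' = fmul s g' \/ g' = fmul s h').

(* A walk g = p_0, p_1, ..., p_k = h in the quotient graph, of length
   k = size p, vertices given by reduced representatives. *)
Fixpoint wh_walk n (g : seq (letter n)) (p : seq (seq (letter n)))
  (h : seq (letter n)) : Prop :=
  match p with
  | [::] => g = h
  | x :: p' => is_reduced x /\ wh_adj g x /\ wh_walk x p' h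
  end.

Definition l1dist m (x y : 'I_m -> Z) : nat :=
  \sum_(i < m) Z.abs_nat (x i - y i)%Z.

(* Quasi-isometric embedding of Z^m into the Whitehead complex of F_n,
   the vertex f x being the conjugacy class of the reduced word f x.
   d(f x, f y) <= r  iff some walk of length <= r joins them;
   d(f x, f y) >= r  iff every walk joining them has length >= r. *)
Definition qi_embeds_Zm_whitehead (n m : nat) : Prop :=
  exists f : ('I_m -> Z) -> seq (letter n),
  (forall x, is_reduced (f x)) /\
  exists L C : R, Rle 1 L /\ Rle 0 C /\
  forall x y : 'I_m -> Z,
    (forall p, wh_walk (f x) p (f y) ->
        Rle (Rminus (Rdiv (INR (l1dist x y)) L) C) (INR (size p))) /\
    (exists p, wh_walk (f x) p (f y) /\
        Rle (INR (size p)) (Rplus (Rmult L (INR (l1dist x y))) C)).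

(* Main.v *)
(* The lower bound comes from Brooks counting quasimorphisms that are bounded on separable
   elements, the upper bound from a product of powers.

   If [g] lies in a proper free factor [A] spanned by part of a basis [beta], omitting its
   [j]-th element, colour [h] by whether [beta^-1 h] starts with [x_j].  This colouring is
   invariant under right multiplication by [A], changes only finitely often under right
   multiplication by any fixed element, and both colours are unbounded.  If the cyclic word
   [g] contained every reduced two-letter word, then at each vertex of the Cayley tree any
   two directions would be joined by a translate of the axis of [g], whose ends have equal
   colour; hence the colouring would be constant far out, a contradiction.  So if [T] contains
   every reduced two-letter word, then the quasimorphism counting occurrences of [T] minus
   occurrences of [T^-1] is bounded on separable elements, and thus coarsely Lipschitz on the
   Whitehead complex.

   Take [W_j = b V b a^(K+j)] with [b V b] containing all reduced two-letter words and [K]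
   larger than [size V], and let [T_i = W_i b].  The lengths of the runs of [a] show that
   neither [T_i] nor its inverse occurs in a power of [W_j], except [T_i] in positive powers
   of [W_i].  The embedding is [x |-> W_0^(x_0) ... W_(m-1)^(x_(m-1))].  It is Lipschitz since
   the classes of [uv] and [u a v], for a letter [a], have the adjacent representatives [vu]
   and [a v u]. *)
Require Import Defs.
From Stdlib Require Import ZArith Reals Lra.
From mathcomp Require Import all_boot zify.

Set Implicit Arguments.
Unset Strict Implicit.
Unset Printing Implicit Defensive.

(* MathComp's [fingraph] exports another [finv]. *)
Local Notation finv := Defs.finv.

(** * Free and cyclic reduction of words *)

Section FreeReduction.
Variable n : nat.
Implicit Types (a b : letter n) (c u v w x g h : seq (letter n)).

(** Reduced words become [sorted compat] and cyclically reduced ones [cycle compat], so that the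
    theory of paths applies. *)
Definition compat a b := b != linv a.

Definition reduce_cons a u :=
  if u is b :: r then (if b == linv a then r else a :: b :: r) else [:: a].

Lemma linvK : involutive (@linv n).
Proof. by case=> i s; rewrite /linv /= negbK. Qed.

Lemma linv_inj : injective (@linv n).
Proof. exact: inv_inj linvK. Qed.

Lemma compat_refl a : compat a a.
Proof. by case: a => i []; rewrite /compat /linv /= xpair_eqE /= andbF. Qed.

Lemma compat_linv a b : compat (linv b) (linv a) = compat a b.
Proof. by rewrite /compat linvK eq_sym -(inj_eq linv_inj b) linvK. Qed.

Lemma reduceE a w : reduce (a :: w) = reduce_cons a (reduce w).
Proof. by []. Qed.

Lemma reduce_cons_sorted a u : sorted compat u -> sorted compat (reduce_cons a u).
Proof.
case: u => [|b r] //= Hp; case: ifP => [_|Hb]; first exact: path_sorted Hp.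
by rewrite /= /compat Hb Hp.
Qed.

Lemma reduce_sorted w : sorted compat (reduce w).
Proof. by elim: w => [|a w IH] //; rewrite reduceE reduce_cons_sorted. Qed.

Lemma reduce_id w : sorted compat w -> reduce w = w.
Proof.
elim: w => [|a w IH] // Hs; rewrite reduceE IH ?(path_sorted Hs) //.
by case: w Hs {IH} => [|b r] //= /andP[Hb _]; rewrite (negbTE Hb).
Qed.

Lemma is_reducedE w : is_reduced w = sorted compat w.
Proof.
apply/eqP/idP => [<-|]; [exact: reduce_sorted | exact: reduce_id].
Qed.

Lemma reduced_reduce w : is_reduced (reduce w).
Proof. by rewrite is_reducedE reduce_sorted. Qed.

(** If [u] starts with [a], its reducedness keeps the next letter from being [linv a], so putting
    [a] back causes no cancellation. *)
Lemma reduce_consK a u : sorted compat u ->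
  reduce_cons a (reduce_cons (linv a) u) = u.
Proof.
case: u => [|b r] /=; first by rewrite eqxx.
rewrite linvK; case: eqP => [->|_] Hp; last by rewrite /= eqxx.
case: r Hp => [|d r] //= /andP[Hd _].
by rewrite (negbTE Hd).
Qed.

Lemma reduce_catr u v : reduce (u ++ reduce v) = reduce (u ++ v).
Proof.
elim: u => [|a u IH]; first by rewrite /= reduce_id // reduce_sorted.
by rewrite !cat_cons !reduceE IH.
Qed.

Lemma reduce_cons_cat a u v : sorted compat u ->
  reduce (reduce_cons a u ++ v) = reduce (a :: u ++ v).
Proof.
case: u => [|b r] //= Hp; case: eqP => [->|_] //.
by rewrite -/(reduce_cons a (reduce (linv a :: r ++ v))) reduceE reduce_consK // reduce_sorted.
Qed.

Lemma reduce_catl u v : reduce (reduce u ++ v) = reduce (u ++ v).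
Proof.
elim: u => [|a u IH] //; rewrite reduceE reduce_cons_cat ?reduce_sorted //.
by rewrite cat_cons !reduceE IH.
Qed.

Lemma reduce_reduce u : reduce (reduce u) = reduce u.
Proof. exact: reduce_catr [::] u. Qed.

Lemma finv_cat u v : finv (u ++ v) = finv v ++ finv u.
Proof. by rewrite /finv map_cat rev_cat. Qed.

Lemma finv_cons a u : finv (a :: u) = rcons (finv u) (linv a).
Proof. by rewrite /finv /= rev_cons. Qed.

Lemma finv_rcons a u : finv (rcons u a) = linv a :: finv u.
Proof. by rewrite /finv map_rcons rev_rcons. Qed.

Lemma finvK : involutive (@finv n).
Proof.
move=> u; rewrite /finv map_rev revK -map_comp.
by apply: map_id_in => a _ /=; rewrite linvK.
Qed.

Lemma size_finv u : size (finv u) = size u.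
Proof. by rewrite /finv size_rev size_map. Qed.

Lemma sorted_finv u : sorted compat (finv u) = sorted compat u.
Proof.
rewrite /finv rev_sorted sorted_map; apply: eq_sorted => a b /=.
exact: compat_linv.
Qed.

Lemma cycle_finv u : cycle compat (finv u) = cycle compat u.
Proof.
rewrite /finv rev_cycle cycle_map; apply: eq_cycle => a b /=.
exact: compat_linv.
Qed.

Lemma reduce_insert u v w : reduce v = [::] -> reduce (u ++ v ++ w) = reduce (u ++ w).
Proof.
by move=> Hv; rewrite -reduce_catr -(reduce_catl v) Hv reduce_catr.
Qed.

Lemma reduce_mulV u : reduce (u ++ finv u) = [::].
Proof.
elim: u => [|a u IH] //; rewrite finv_cons -cats1 /=.
rewrite catA -/(reduce_cons a _) -reduce_catl IH /=.
by rewrite eqxx.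
Qed.

Lemma reduce_Vmul u : reduce (finv u ++ u) = [::].
Proof. by rewrite -{2}(finvK u) reduce_mulV. Qed.

(** Uniqueness of inverses: the product of [finv u], [u] and [finv (reduce u)] is evaluated in two
    ways. *)
Lemma reduce_finv u : reduce (finv u) = finv (reduce u).
Proof.
have Hs : reduce (finv (reduce u)) = finv (reduce u).
  by rewrite reduce_id // sorted_finv reduce_sorted.
have := reduce_insert [::] (finv (reduce u)) (reduce_Vmul u).
rewrite /= Hs -catA => <-.
by rewrite -reduce_catr -[reduce (u ++ _)]reduce_catl reduce_mulV cats0.
Qed.

(* The cancelled part [c] is what relates a product in the free group to concatenation. *)
Lemma reduce_cat_cancel u v : sorted compat u -> sorted compat v ->
  exists u' v' c, [/\ u = u' ++ c, v = finv c ++ v' & reduce (u ++ v) = u' ++ v'].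
Proof.
elim: v u => [|a v IH] u Hu Hv.
  by exists u, [::], [::]; rewrite !cats0 reduce_id.
case/lastP: u Hu => [|u b] Hu.
  by exists [::], (a :: v), [::]; rewrite reduce_id.
have Hv' := path_sorted Hv.
have Hu' : sorted compat u by move: Hu; rewrite -cats1 => /cat_sorted2[].
case: (a =P linv b) => [E|/eqP Hab].
  have [u' [v' [c [-> Ev Er]]]] := IH u Hu' Hv'.
  exists u', v', (rcons c b); rewrite finv_rcons rcons_cat; split=> //.
    by rewrite E Ev.
  rewrite -rcons_cat -cats1 -catA /= E.
  rewrite (reduce_insert (u' ++ c) v (v := [:: b; linv b])) //; last by rewrite /= eqxx.
exists (rcons u b), (a :: v), [::]; rewrite cats0; split=> //.
apply: reduce_id; case: u Hu {Hu'} => [|d u] /=.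
  by move=> _; rewrite /compat Hab.
by move=> Hp; rewrite cat_path Hp /= last_rcons /compat Hab.
Qed.

(** Mutually inverse end letters are moved into [c] and [finv c]. Two letters go at a time, hence
    the induction on a bound for the length. *)
Lemma cyclic_reduction g : sorted compat g ->
  exists c g', g = c ++ g' ++ finv c /\ cycle compat g'.
Proof.
have [k] := ubnP (size g); elim: k g => // k IH [|a g] Hk Hs; first by exists [::], [::].
case/lastP: g Hk Hs => [|g z] Hk Hs.
  by exists [::], [:: a]; rewrite /= compat_refl.
case: (z =P linv a) => [E|/eqP Hz].
  have Hg : sorted compat g.
    by move: Hs => /= ; rewrite rcons_path => /andP[/path_sorted].
  have [|c [g' [Eg Hc]]] := IH g _ Hg.
    by move: Hk; rewrite /= size_rcons; lia.
  exists (a :: c), g'; split=> //.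
  by rewrite Eg E finv_cons -!cats1 !catA.
exists [::], (a :: rcons g z); rewrite cats0; split=> //=.
rewrite rcons_path last_rcons; move: Hs => /= -> /=.
by rewrite /compat; apply: contraNneq Hz => ->; rewrite linvK.
Qed.

End FreeReduction.

(** * Substitutions as endomorphisms of the free group *)

Section Substitution.
Variables (n : nat) (b : 'I_n -> seq (letter n)).
Implicit Types (u v w : seq (letter n)).

Definition letter_image (a : letter n) := if a.2 then finv (b a.1) else b a.1.

Lemma fsubstE w : fsubst b w = reduce (flatten (map letter_image w)).
Proof. by []. Qed.

Lemma letter_image_linv a : letter_image (linv a) = finv (letter_image a).
Proof. by case: a => i [] //=; rewrite /letter_image /= finvK. Qed.

Lemma fsubst_cat u v : fsubst b (u ++ v) = reduce (fsubst b u ++ fsubst b v).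
Proof. by rewrite !fsubstE map_cat flatten_cat reduce_catl reduce_catr. Qed.

Lemma fsubst_cons a w : fsubst b (a :: w) = reduce (letter_image a ++ fsubst b w).
Proof. by rewrite !fsubstE /= reduce_catr. Qed.

Lemma fsubst_sorted w : sorted (@compat n) (fsubst b w).
Proof. exact: reduce_sorted. Qed.

Lemma fsubst_reduce w : fsubst b (reduce w) = fsubst b w.
Proof.
elim: w => [|a w IH] //; rewrite reduceE fsubst_cons -IH.
case: (reduce w) => [|d r]; first by rewrite /= fsubst_cons.
rewrite /reduce_cons; case: eqP => [->|_]; last by rewrite fsubst_cons.
rewrite fsubst_cons letter_image_linv reduce_catr catA.
rewrite (reduce_insert [::] _ (reduce_mulV _)) /= reduce_id //.
exact: fsubst_sorted.
Qed.

Lemma fsubst_finv w : fsubst b (finv w) = finv (fsubst b w).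
Proof.
elim: w => [|a w IH] //; rewrite finv_cons -cats1 fsubst_cat IH.
rewrite !fsubst_cons -[finv (reduce (_ ++ _))]reduce_finv finv_cat -letter_image_linv.
by rewrite cats0 reduce_catr.
Qed.

Lemma size_reduce w : size (reduce w) <= size w.
Proof.
elim: w => [|a w IH] //; rewrite reduceE /reduce_cons.
by move: IH; case: (reduce w) => [|d r] //=; case: ifP => _ /=; lia.
Qed.

(** Applied to a basis and to the inverse substitution, this makes a change of basis bi-Lipschitz
    for word length. *)
Lemma size_fsubst w : size (fsubst b w) <= (\max_(i < n) size (b i)) * size w.
Proof.
rewrite fsubstE; apply: leq_trans (size_reduce _) _.
elim: w => [|a w IH] //=; rewrite size_cat mulnS leq_add //.
have -> : size (letter_image a) = size (b a.1).
  by rewrite /letter_image; case: ifP; rewrite ?size_finv.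
exact: leq_bigmax.
Qed.

End Substitution.

Lemma fsubst_comp n (b y : 'I_n -> seq (letter n)) w :
  (forall i, fsubst b (y i) = [:: (i, false)]) ->
  fsubst b (fsubst y w) = reduce w.
Proof.
move=> Hy; elim: w => [|a w IH] //.
rewrite fsubst_cons fsubst_reduce fsubst_cat IH reduce_catr.
have -> // : fsubst b (letter_image y a) = [:: a].
by case: a => i [] /=; rewrite /letter_image /= ?fsubst_finv Hy.
Qed.

(** * First letters of reduced products *)

Section Heads.
Variable n : nat.
Implicit Types (c k u v w : seq (letter n)).

Lemma reduce_letters w (S : {set 'I_n}) :
  all (fun a => a.1 \in S) w -> all (fun a => a.1 \in S) (reduce w).
Proof.
elim: w => [|a w IH] //= /andP[Ha /IH].
case: (reduce w) => [|d r] /=; first by rewrite Ha.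
by case: ifP => _ /andP[Hd Hr] /=; rewrite ?Ha ?Hd ?Hr.
Qed.

(** Only letters indexed by [S] cancel. If part of [k] survives, its head does; if all of [k]
    cancels, neither head can be [(j, false)]. *)
Lemma ohead_reduce_cat k w (S : {set 'I_n}) j :
  sorted (@compat n) k -> all (fun a => a.1 \in S) w -> j \notin S ->
  (ohead (reduce (k ++ w)) == Some (j, false)) = (ohead k == Some (j, false)).
Proof.
move=> Hk Hw Hj; rewrite -reduce_catr.
have [u' [v' [c [Eu Ev ->]]]] := reduce_cat_cancel Hk (reduce_sorted w).
have := reduce_letters Hw; rewrite Ev all_cat => /andP[Hc Hv].
rewrite Eu; case: u' {Eu} => [|d u'] //=.
have notS x : all (fun a : letter n => a.1 \in S) x -> (ohead x == Some (j, false)) = false.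
  case: x => [|[i s] x] //= /andP[Hi _]; apply/eqP => -[E _].
  by rewrite E (negbTE Hj) in Hi.
rewrite !notS //; move: Hc; rewrite /finv all_rev all_map.
by apply: sub_all.
Qed.

Lemma ohead_reduce_short k w :
  sorted (@compat n) k -> size w < size k -> ohead (reduce (k ++ w)) = ohead k.
Proof.
move=> Hk Hs; rewrite -reduce_catr.
have [u' [v' [c [Eu Ev ->]]]] := reduce_cat_cancel Hk (reduce_sorted w).
have := size_reduce w; move: Hs; rewrite Ev {1}Eu !size_cat size_finv.
by rewrite Eu; case: u' {Eu} => [|d u'] //=; lia.
Qed.

End Heads.

(** * Colourings of the Cayley tree and separable elements *)

Section Colorings.
Variable n : nat.
Implicit Types (g h u v w x : seq (letter n)) (col : seq (letter n) -> bool).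

Definition right_invariant col g :=
  forall h, sorted (@compat n) h -> col (reduce (h ++ g)) = col h.

(** A threshold linear in the length of [x], with one [B] for all [x], is stable under conjugation;
    for single letters it makes the colouring locally constant far out in the tree. *)
Definition almost_invariant col :=
  exists B, forall h x, sorted (@compat n) h -> B * (size x).+1 <= size h ->
    col (reduce (h ++ x)) = col h.

Definition nonconstant_at_infinity col :=
  forall R, exists h1 h2, [/\ sorted (@compat n) h1, sorted (@compat n) h2,
    R <= size h1, R <= size h2 & col h1 != col h2].

(* If the basis is [beta] and the free factor omits its [j]-th element, colour [h]
   by whether [beta^-1 h] starts with [x_j]. *)
Lemma separable_coloring g : separable g ->
  exists col, [/\ right_invariant col g, almost_invariant col
    & nonconstant_at_infinity col].
Proof.
case=> Hg [b [S [[Hb [binj bsurj]] [HS [w [Hw Ew]]]]]].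
have [j _ Hj] : exists2 j, j \in setT & j \notin S.
  by apply/subsetPn; move: HS; rewrite eqEsubset subsetT.
(* Substituting [y] inverts the automorphism given by the basis: [y i] writes the [i]-th generator
   in that basis. *)
have [y Hy] : exists y : 'I_n -> seq (letter n),
    forall i, is_reduced (y i) /\ fsubst b (y i) = [:: (i, false)].
  apply: (fin_all_exists (P := fun i u => is_reduced u /\ fsubst b u = [:: (i, false)])).
  by move=> i; have [|u Hu E] := bsurj [:: (i, false)]; [rewrite is_reducedE|exists u].
have by_id u : fsubst b (fsubst y u) = reduce u.
  by apply: fsubst_comp => i; case: (Hy i).
have yb_id u : fsubst y (fsubst b u) = reduce u.
  apply: binj; rewrite ?reduced_reduce // ?is_reducedE ?fsubst_sorted //.
  by rewrite by_id fsubst_reduce fsubstE reduce_reduce.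
pose col h := ohead (fsubst y h) == Some (j, false).
set M := (\max_(i < n) size (b i)).
set M' := (\max_(i < n) size (y i)).
have bound h : sorted (@compat n) h -> size h <= M * size (fsubst y h).
  by move=> Hh; rewrite -{1}(reduce_id Hh) -by_id size_fsubst.
have bound' k : sorted (@compat n) k -> size k <= M' * size (fsubst b k).
  by move=> Hh; rewrite -{1}(reduce_id Hh) -yb_id size_fsubst.
exists col; split.
- move=> h Hh; rewrite /col fsubst_reduce fsubst_cat -Ew yb_id reduce_catr.
  exact: ohead_reduce_cat (fsubst_sorted _ _) Hw Hj.
(* Dividing by [M.+1] leaves a [y]-image of [h] longer than [M' * size x], hence longer than that of
   [x], so its head survives. *)
- exists (M.+1 * M'.+1) => h x Hh Hs; rewrite /col fsubst_reduce fsubst_cat.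
  rewrite ohead_reduce_short ?fsubst_sorted //.
  have := bound h Hh; have := size_fsubst y x; rewrite -/M'.
  move: (size (fsubst y x)) (size (fsubst y h)) => p q Hp Hq.
  have : M.+1 * (M'.+1 * (size x).+1) <= M.+1 * q.
    by rewrite mulnA; nia.
  by rewrite leq_pmul2l //; nia.
(* The witnesses are the images of a positive and a negative power of [x_j]; the exponent exceeds
   [M' * R] to force length at least [R]. *)
- move=> R; pose k s := nseq (M' * R).+1 (j, s) : seq (letter n).
  have Hk s : sorted (@compat n) (k s).
    rewrite /k; elim: (M' * R) => [|N IH] //=; rewrite [path _ _ _]IH andbT.
    exact: compat_refl.
  exists (fsubst b (k false)), (fsubst b (k true)).
  have Hsz s : R <= size (fsubst b (k s)).
    have := bound' _ (Hk s); rewrite size_nseq ltn_mul2l.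
    by case/andP => _ /ltnW.
  split; try exact: fsubst_sorted; try exact: Hsz.
  rewrite /col !yb_id !reduce_id //.
  have -> : ohead (k false) == Some (j, false) by exact: eqxx.
  by have /negbTE-> : ohead (k true) != Some (j, false) by apply/eqP => -[].
Qed.

(** Translating the colouring by [finv c] on the right passes from a separable element to its
    cyclically reduced core. *)
Lemma coloring_conj col c g : right_invariant col (reduce (c ++ g ++ finv c)) ->
  almost_invariant col -> nonconstant_at_infinity col ->
  exists col', [/\ right_invariant col' g, almost_invariant col'
    & nonconstant_at_infinity col'].
Proof.
move=> Hg [B HB] Hn; exists (fun h => col (reduce (h ++ finv c))); split.
- move=> h Hh; rewrite reduce_catl.
  rewrite -(Hg (reduce (h ++ finv c)) (reduce_sorted _)) reduce_catl reduce_catr -catA.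
  have -> : (h ++ finv c) ++ c ++ g ++ finv c = h ++ (finv c ++ c) ++ g ++ finv c.
    by rewrite !catA.
  by rewrite (reduce_insert h (g ++ finv c) (reduce_Vmul c)).
- exists (B * (size c).+1) => h x Hh Hs.
  rewrite reduce_catl -catA HB //; last first.
    by rewrite size_cat size_finv; nia.
  by rewrite HB // size_finv; nia.
- move=> R; have [h1 [h2 [H1 H2 S1 S2 Hc]]] := Hn (maxn R (B * (size c).+1)).
  move: S1 S2; rewrite !geq_max => /andP[S1 T1] /andP[S2 T2].
  by exists h1, h2; split=> //; rewrite !HB // size_finv.
Qed.

Lemma right_invariant_finv col g : right_invariant col g -> right_invariant col (finv g).
Proof.
move=> Hg h Hh; rewrite -Hg ?reduce_sorted // reduce_catl -catA.
have -> : h ++ finv g ++ g = h ++ (finv g ++ g) ++ [::] by rewrite cats0.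
by rewrite reduce_insert ?reduce_Vmul // cats0 reduce_id.
Qed.

Definition wpow N g := flatten (nseq N g).

Lemma right_invariant_wpow col g N : right_invariant col g -> right_invariant col (wpow N g).
Proof.
move=> Hg; elim: N => [|N IH] h Hh; first by rewrite cats0 reduce_id.
by rewrite /wpow /= catA -reduce_catl IH ?reduce_sorted // Hg.
Qed.

Lemma size_wpow N g : size (wpow N g) = N * size g.
Proof. by rewrite /wpow size_flatten /shape map_nseq sumn_nseq mulnC. Qed.

Lemma wpowD N N' g : wpow (N + N') g = wpow N g ++ wpow N' g.
Proof. by rewrite /wpow nseqD flatten_cat. Qed.

Lemma wpowSr N g : wpow N.+1 g = wpow N g ++ g.
Proof. by rewrite -addn1 wpowD /wpow /= cats0. Qed.

Lemma finv_wpow N g : finv (wpow N g) = wpow N (finv g).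
Proof.
elim: N => [|N IH] //; rewrite wpowSr finv_cat IH //.
Qed.

Lemma path_wpow g N (z : letter n) : cycle (@compat n) g -> last z g = z ->
  path (@compat n) z (wpow N g) /\ last z (wpow N g) = z.
Proof.
move=> Hc Hz; elim: N => [|N [IH1 IH2]] //.
rewrite /wpow /= cat_path last_cat Hz IH1 IH2 andbT; split=> //.
by case: g Hc Hz {IH1 IH2} => [|a g] // Hc <-; have := Hc; rewrite (cycle_path z).
Qed.

(** A geodesic that leaves [u] through [b] and then follows a translate of the axis of [g]. *)
Lemma sorted_cat_wpow g p q u (b : letter n) N : cycle (@compat n) g ->
  g = p ++ b :: q -> sorted (@compat n) (rcons u b) ->
  sorted (@compat n) (u ++ b :: q ++ wpow N g).
Proof.
move=> Hc Eg Hu.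
have Hq : path (@compat n) b q.
  have : sorted (@compat n) g by case: g Hc {Eg} => [|a g] //=; rewrite rcons_path => /andP[].
  by rewrite Eg => /cat_sorted2[_].
have [|Hw _] := path_wpow N (z := last b q) Hc; first by rewrite Eg last_cat.
have Hbq : path (@compat n) b (q ++ wpow N g) by rewrite cat_path Hq.
case: u Hu => [|d u] //=; rewrite rcons_path cat_path => /andP[-> Hb] /=.
by rewrite Hb Hbq.
Qed.

(* Downward induction on the depth of the cone at [u]: two distinct children [ua], [ub]
   are joined by a translate of the axis of [g], whose two ends have the same colour. *)
Lemma full_word_coloring_constant col g : cycle (@compat n) g ->
  (forall a b : letter n, a != b -> infix [:: linv a; b] g) ->
  right_invariant col g -> almost_invariant col ->
  ~ nonconstant_at_infinity col.
Proof.
(* [B * 2] is the threshold of [HB] for a single letter. *)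
move=> Hc Hfull Hg [B HB] Hn; set R := B * 2.
suff mono k u v1 v2 : R <= size u + k ->
    sorted (@compat n) (u ++ v1) -> sorted (@compat n) (u ++ v2) ->
    R <= size (u ++ v1) -> R <= size (u ++ v2) -> col (u ++ v1) = col (u ++ v2).
  have [h1 [h2 [H1 H2 S1 S2 /eqP]]] := Hn R; apply.
  by apply: (mono R [::]).
elim: k u v1 v2 => [|k IH] u v1 v2 Hk H1 H2 S1 S2.
  have same v : sorted (@compat n) (u ++ v) -> col (u ++ v) = col u.
    elim/last_ind: v => [|v a IHv]; first by rewrite cats0.
    rewrite -cats1 catA => Hs.
    have [Huv _] := cat_sorted2 Hs.
    rewrite -(reduce_id Hs) HB ?IHv //= size_cat.
    by move: Hk; rewrite /R; lia.
  by rewrite !same.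
case: (leqP R (size u)) => HuR; first by apply: IH => //; lia.
case: v1 H1 S1 => [|a v1] H1 S1; first by rewrite cats0 in S1; lia.
case: v2 H2 S2 => [|b v2] H2 S2; first by rewrite cats0 in S2; lia.
have Hsz (d : letter n) : R <= size (rcons u d) + k by rewrite size_rcons; lia.
case: (eqVneq a b) => [E|Hab].
  by move: H1 H2 S1 S2; rewrite -E -!cat_rcons; apply: IH.
(* A translate of the axis passes through the vertex [u] between [linv a] and [b]: forwards it reads
   [b :: q], backwards [a :: finv p]. *)
have /infixP[p [q Eg]] := Hfull a b Hab.
have Eg1 : g = rcons p (linv a) ++ b :: q by rewrite Eg cat_rcons.
have Eg2 : finv g = rcons (finv q) (linv b) ++ a :: finv p.
  by rewrite Eg1 finv_cat finv_rcons finv_cons linvK.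
have Ng : 0 < size g by rewrite Eg1 size_cat /= addnS.
have Ha : sorted (@compat n) (rcons u a).
  by move: H1; rewrite -cat_rcons => /cat_sorted2[].
have Hb : sorted (@compat n) (rcons u b).
  by move: H2; rewrite -cat_rcons => /cat_sorted2[].
have Hc' : cycle (@compat n) (finv g) by rewrite cycle_finv.
have L1 := sorted_cat_wpow R Hc' Eg2 Ha.
have L2 := sorted_cat_wpow R Hc Eg1 Hb.
have big g' (x : seq (letter n)) : 0 < size g' -> R <= size (x ++ wpow R g').
  by move=> Hg'; rewrite size_cat size_wpow; nia.
(* By induction, each child's cone is constant far out, so both points may be moved far along the
   axis. *)
have -> : col (u ++ a :: v1) = col (u ++ a :: finv p ++ wpow R (finv g)).
  move: H1 S1 L1; rewrite -!(cat_rcons a u) => H1 S1 L1; apply: IH => //.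
  by rewrite catA big // size_finv.
have -> : col (u ++ b :: v2) = col (u ++ b :: q ++ wpow R g).
  move: H2 S2 L2; rewrite -!(cat_rcons b u) => H2 S2 L2; apply: IH => //.
  by rewrite catA big.
(* Right multiplication by the power [R + R.+1] of [g] carries the backward point of the axis to the
   forward one. *)
rewrite -(right_invariant_wpow (R + R.+1) Hg L1) wpowD /wpow /= -/(wpow R g).
rewrite -(reduce_id L2); congr (col _).
have cancel x N w : reduce (x ++ wpow N (finv g) ++ wpow N g ++ w) = reduce (x ++ w).
  by rewrite -finv_wpow catA (catA _ (wpow N g)) -(catA x) -catA reduce_insert ?reduce_Vmul.
have -> : (u ++ a :: finv p ++ wpow R (finv g)) ++ wpow R g ++ g ++ wpow R g =
   (u ++ a :: finv p) ++ wpow R (finv g) ++ wpow R g ++ g ++ wpow R g.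
  by rewrite -[(u ++ a :: finv p) ++ _]catA -[(u ++ _) ++ _]catA cat_cons -catA.
rewrite cancel {1}Eg.
have -> : (u ++ a :: finv p) ++ (p ++ [:: linv a; b] ++ q) ++ wpow R g =
   u ++ (finv (p ++ [:: linv a]) ++ (p ++ [:: linv a])) ++ b :: q ++ wpow R g.
  by rewrite finv_cat /= linvK -!catA.
by rewrite reduce_insert ?reduce_Vmul.
Qed.

(* The special case of Whitehead's cut-vertex lemma in which the Whitehead graph is complete. *)
Lemma separable_not_full c g T :
  separable (c ++ g ++ finv c) -> cycle (@compat n) g ->
  (forall a b : letter n, a != b -> infix [:: linv a; b] T) ->
  ~~ infix T g /\ ~~ infix T (finv g).
Proof.
move=> Hsep Hc HT.
have [col0 [G0 A0 N0]] := separable_coloring Hsep.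
have [|col [G A N]] := @coloring_conj col0 c g _ A0 N0.
  by rewrite reduce_id // -is_reducedE; case: Hsep.
split; apply/negP => HTg.
  apply: (full_word_coloring_constant Hc _ G A N) => a b Hab.
  exact: infix_trans (HT _ _ Hab) HTg.
apply: (full_word_coloring_constant (g := finv g) _ _ _ A N).
- by rewrite cycle_finv.
- by move=> a b Hab; exact: infix_trans (HT _ _ Hab) HTg.
- exact: right_invariant_finv.
Qed.

End Colorings.

#[local] Arguments prefix : simpl never.

(** * Brooks counting quasimorphisms *)

Section Counting.
Variables (n : nat) (T : seq (letter n)).
Implicit Types (c g h u v w x : seq (letter n)).

Fixpoint occ w : nat :=
  if w is _ :: w' then prefix T w + occ w' else 0.

Lemma occ_eq0 w : ~~ infix T w -> occ w = 0.
Proof.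
elim: w => [|a w IH] //=; rewrite negb_or => /andP[Hp /IH ->].
by rewrite (negbTE Hp).
Qed.

Lemma prefix_cat_long u v : size T <= size u -> prefix T (u ++ v) = prefix T u.
Proof. by move=> Hs; rewrite !prefixE takel_cat. Qed.

Lemma occ_cat_ge u v : occ u + occ v <= occ (u ++ v).
Proof.
elim: u => [|a u IH] //=; rewrite -addnA leq_add // -cat_cons.
case: (boolP (prefix T (a :: u))) => // Hp.
by have Hs := size_prefix Hp; rewrite prefix_cat_long // Hp.
Qed.

(** The new occurrences straddle the junction, so they start among the last [size T] letters of
    [u]. *)
Lemma occ_cat_le u v : occ (u ++ v) <= occ u + occ v + minn (size u) (size T).
Proof.
elim: u => [|a u IH]; first by rewrite /=; lia.
case: (leqP (size T) (size (a :: u))) => Hs.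
  by have := prefix_cat_long v Hs; rewrite /= => ->; move: Hs IH => /=; lia.
by move: Hs IH => /=; case: (prefix _ _); case: (prefix _ _); lia.
Qed.

Definition brooks w : Z := (Z.of_nat (occ w) - Z.of_nat (occ (finv w)))%Z.

Let t : Z := Z.of_nat (size T).

Lemma brooks_finv w : brooks (finv w) = (- brooks w)%Z.
Proof. by rewrite /brooks finvK; lia. Qed.

(** The junction errors for [T] and its inverse both lie between 0 and [t] and enter with opposite
    signs. *)
Lemma brooks_cat u v : (Z.abs (brooks (u ++ v) - brooks u - brooks v) <= t)%Z.
Proof.
rewrite /brooks finv_cat /t.
have := occ_cat_ge u v; have := occ_cat_le u v.
have := occ_cat_ge (finv v) (finv u); have := occ_cat_le (finv v) (finv u).
by lia.
Qed.

(** The cancelled part contributes opposite values to [u] and [v]; three concatenations remain,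
    costing [t] each. *)
Lemma brooks_mul u v : sorted (@compat n) u -> sorted (@compat n) v ->
  (Z.abs (brooks (reduce (u ++ v)) - brooks u - brooks v) <= 3 * t)%Z.
Proof.
move=> Hu Hv; have [u' [v' [c [-> -> ->]]]] := reduce_cat_cancel Hu Hv.
have := @brooks_cat u' v'; have := @brooks_cat u' c; have := @brooks_cat (finv c) v'.
by rewrite brooks_finv; lia.
Qed.

Lemma brooks_conjugate g h : is_reduced g -> conjugate g h ->
  (Z.abs (brooks h - brooks g) <= 6 * t)%Z.
Proof.
rewrite is_reducedE => Hg [x]; rewrite is_reducedE => Hx ->; rewrite /fmul.
have Hx' : sorted (@compat n) (finv x) by rewrite sorted_finv.
have := brooks_mul Hx' Hg; have := brooks_mul (reduce_sorted (finv x ++ g)) Hx.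
by rewrite brooks_finv; lia.
Qed.

Hypothesis T_full : forall a b : letter n, a != b -> infix [:: linv a; b] T.

(** The cyclically reduced core contributes 0 and the two conjugating parts cancel, leaving two
    junctions. *)
Lemma brooks_separable g : separable g -> (Z.abs (brooks g) <= 2 * t)%Z.
Proof.
move=> Hsep; have := Hsep.1; rewrite is_reducedE => /cyclic_reduction[c [g' [Eg Hc]]].
rewrite Eg in Hsep *.
have [/occ_eq0 H1 /occ_eq0 H2] := separable_not_full Hsep Hc T_full.
have := @brooks_cat c (g' ++ finv c); have := @brooks_cat g' (finv c).
have -> : brooks g' = 0%Z by rewrite /brooks H1 H2.
by rewrite brooks_finv; lia.
Qed.

Lemma reduced_conjugate g h : conjugate g h -> is_reduced h.
Proof. by case=> x _ ->; exact: reduced_reduce. Qed.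

(** 17 = 6 + 6 + 3 + 2: two changes of representative, one product, one separable factor. *)
Lemma brooks_adj g h : is_reduced g -> is_reduced h -> wh_adj g h ->
  (Z.abs (brooks g - brooks h) <= 17 * t)%Z.
Proof.
move=> Hg Hh [g' [h' [s [Cg [Ch [Hs Hadj]]]]]].
have := brooks_conjugate Hg Cg; have := brooks_conjugate Hh Ch.
have := brooks_separable Hs.
have := reduced_conjugate Cg; have := reduced_conjugate Ch; have := Hs.1.
rewrite !is_reducedE => Rs Rh Rg.
case: Hadj => ->.
  by have := brooks_mul Rs Rg; rewrite /fmul; lia.
by have := brooks_mul Rs Rh; rewrite /fmul; lia.
Qed.

Lemma brooks_walk g p h : is_reduced g -> wh_walk g p h ->
  (Z.abs (brooks g - brooks h) <= 17 * t * Z.of_nat (size p))%Z.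
Proof.
elim: p g => [|x p IH] g Hg; first by move=> /= ->; lia.
case=> Hx [Hadj /(IH _ Hx)]; have := brooks_adj Hg Hx Hadj.
have -> : Z.of_nat (size (x :: p)) = (Z.of_nat (size p) + 1)%Z by exact: Nat2Z.inj_succ.
by rewrite Z.mul_add_distr_l; lia.
Qed.

End Counting.

(** * Upper bounds for distances in the Whitehead complex *)

Section Walks.
Variable n : nat.
Hypothesis n_ge2 : 2 <= n.
Implicit Types (g h u v w s : seq (letter n)).

(** In the standard basis the letter spans a factor of rank one, which is proper since [n >= 2]. *)
Lemma separable_letter (a : letter n) : separable [:: a].
Proof.
split; first by rewrite is_reducedE.
pose b i : seq (letter n) := [:: (i, false)].
have bE w : fsubst b w = reduce w.
  rewrite fsubstE; congr reduce.
  by elim: w => [|[i []] w IH] //=; rewrite IH.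
exists b, [set a.1]; split; last split.
- split; first by move=> i; rewrite is_reducedE.
  split=> [u v /eqP Hu /eqP Hv|g /eqP Hg]; first by rewrite !bE Hu Hv.
  by exists g; [apply/eqP|rewrite bE].
- by apply/eqP => /(congr1 (fun A : {set 'I_n} => #|A|)); rewrite cards1 cardsT card_ord; lia.
- by exists [:: a]; rewrite /= inE eqxx bE.
Qed.

Lemma conjugate_rotate u v : conjugate (reduce (u ++ v)) (reduce (v ++ u)).
Proof.
exists (reduce u); first exact: reduced_reduce.
have E : reduce (finv (reduce u) ++ reduce (u ++ v)) = reduce v.
  have /= <- := reduce_insert [::] v (reduce_Vmul (reduce u)).
  by rewrite -catA -[RHS]reduce_catr (reduce_catl u v).
by rewrite /fmul E reduce_catl reduce_catr.
Qed.

Definition reach k g h := exists2 p, wh_walk g p h & size p <= k.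

Lemma reach0 g : reach 0 g g. Proof. by exists [::]. Qed.

Lemma reach_le k k' g h : k <= k' -> reach k g h -> reach k' g h.
Proof. by move=> Hk [p Hp Hs]; exists p => //; apply: leq_trans Hk. Qed.

Lemma reach_trans k k' g h x : reach k g h -> reach k' h x -> reach (k + k') g x.
Proof.
case=> p Hp Hs [q Hq Hs']; exists (p ++ q); last by rewrite size_cat leq_add.
by elim: p g Hp {Hs} => [|y p IH] g /= => [-> //|[Hy [Hadj /IH]]].
Qed.

Lemma wh_adj_sym g h : wh_adj g h -> wh_adj h g.
Proof.
case=> g' [h' [s [Cg [Ch [Hs Hadj]]]]]; exists h', g', s; do 3 split=> //.
by case: Hadj; [right|left].
Qed.

Lemma wh_adj_insert_letter u (a : letter n) v :
  wh_adj (reduce (u ++ v)) (reduce (u ++ a :: v)).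
Proof.
exists (reduce (v ++ u)), (reduce ((a :: v) ++ u)), [:: a].
split; first exact: conjugate_rotate.
split; first exact: conjugate_rotate.
split; first exact: separable_letter.
by left; rewrite /fmul reduce_catr.
Qed.

Lemma reach_insert u s v : reach (size s) (reduce (u ++ v)) (reduce (u ++ s ++ v)).
Proof.
elim: s u v => [|a s IH] u v /=; first exact: reach0.
rewrite -add1n -cat_rcons; apply: reach_trans (IH _ _).
rewrite cat_rcons; exists [:: reduce (u ++ a :: v)] => //.
by split; [exact: reduced_reduce|split=> //; exact: wh_adj_insert_letter].
Qed.

Lemma reach_sym k g h : is_reduced g -> reach k g h -> reach k h g.
Proof.
move=> Hg [p Hp Hs]; apply: (reach_le Hs).
elim: p g Hg Hp {Hs} => [|x p IH] g Hg /=; first by move=> ->; exact: reach0.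
case=> Hx [Hadj /(IH _ Hx) Hr]; rewrite -addn1; apply: reach_trans Hr _.
by exists [:: g] => //; split=> //; split=> //; exact: wh_adj_sym.
Qed.

Definition zpow (g : seq (letter n)) (k : Z) :=
  if (0 <=? k)%Z then wpow (Z.abs_nat k) g else wpow (Z.abs_nat k) (finv g).

Lemma reach_wpow u v g k l : k <= l ->
  reach ((l - k) * size g) (reduce (u ++ wpow k g ++ v)) (reduce (u ++ wpow l g ++ v)).
Proof.
move=> Hkl; rewrite -size_wpow -{2}(subnK Hkl) wpowD -catA.
exact: reach_insert.
Qed.

Lemma reach_zpow u v g k l :
  reach (Z.abs_nat (k - l) * size g)
    (reduce (u ++ zpow g k ++ v)) (reduce (u ++ zpow g l ++ v)).
Proof.
have same g' i j : reach (Z.abs_nat (Z.of_nat i - Z.of_nat j) * size g')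
    (reduce (u ++ wpow i g' ++ v)) (reduce (u ++ wpow j g' ++ v)).
  case: (leqP i j) => Hij.
    by apply: reach_le (reach_wpow _ _ _ Hij); rewrite leq_mul //; lia.
  apply: reach_sym (reduced_reduce _) _.
  by apply: reach_le (reach_wpow _ _ _ (ltnW Hij)); rewrite leq_mul //; lia.
(* For exponents of opposite sign the walk passes through exponent 0, and the absolute values add up
   to the difference. *)
have opp g1 g2 i j : size g1 = size g2 -> reach ((i + j) * size g1)
    (reduce (u ++ wpow i g1 ++ v)) (reduce (u ++ wpow j g2 ++ v)).
  move=> E; rewrite mulnDl {2}E; apply: (reach_trans (h := reduce (u ++ v))).
    rewrite -size_wpow; apply: reach_sym (reduced_reduce _) _; exact: reach_insert.
  rewrite -size_wpow; exact: reach_insert.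
rewrite /zpow; case: Z.leb_spec => Hk; case: Z.leb_spec => Hl.
- by apply: reach_le (same _ _ _); rewrite leq_mul //; lia.
- by apply: reach_le (opp _ _ _ _ _); rewrite ?size_finv // leq_mul //; lia.
- by apply: reach_le (opp _ _ _ _ _); rewrite ?size_finv // leq_mul //; lia.
- by apply: reach_le (same _ _ _); rewrite size_finv leq_mul //; lia.
Qed.

Definition zprod (I : Type) (W : I -> seq (letter n)) (r : seq I) (x : I -> Z) :=
  flatten [seq zpow (W j) (x j) | j <- r].

(** Coordinates are changed one at a time; [u] absorbs those already changed. *)
Lemma reach_zprod (I : Type) (W : I -> seq (letter n)) (r : seq I) (x y : I -> Z) M u v :
  (forall j, size (W j) <= M) ->
  reach (M * \sum_(j <- r) Z.abs_nat (x j - y j)%Z)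
    (reduce (u ++ zprod W r x ++ v)) (reduce (u ++ zprod W r y ++ v)).
Proof.
move=> HM; elim: r u => [|j r IH] u; first by rewrite big_nil muln0; exact: reach0.
rewrite big_cons /zprod /= -!/(zprod _ _ _) mulnDr -!catA.
apply: (reach_trans (h := reduce (u ++ zpow (W j) (y j) ++ zprod W r x ++ v))).
  by apply: reach_le (reach_zpow _ _ _ _ _); rewrite mulnC leq_mul.
by rewrite !(catA u); exact: IH.
Qed.

End Walks.

(** * Lengths of the runs of a letter *)

Section Runs.
Variable n : nat.
Implicit Types (c d e : letter n) (u v w : seq (letter n)).

Definition incr_head (s : seq nat) := if s is k :: s' then k.+1 :: s' else [::].

(** Empty runs are recorded too, one entry for each gap between letters other than [c], so that
    cutting at such a letter splits the list exactly. *)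
Fixpoint runs c w : seq nat :=
  if w is d :: w' then
    if d == c then incr_head (runs c w') else 0 :: runs c w'
  else [:: 0].

Lemma runs_nonempty c w : runs c w != [::].
Proof. by elim: w => [|d w IH] //=; case: ifP => // _; case: (runs c w) IH. Qed.

Lemma runs_cat c u d v : d != c -> runs c (u ++ d :: v) = runs c u ++ runs c v.
Proof.
move=> Hd; elim: u => [|e u IH] /=; first by rewrite (negbTE Hd).
case: ifP => _; rewrite IH //.
by case: (runs c u) (runs_nonempty c u).
Qed.

Lemma runs_nseq c k : runs c (nseq k c) = [:: k].
Proof. by elim: k => [|k IH] //=; rewrite eqxx IH. Qed.

Lemma runs_nseq_neq c d k : d != c -> all (eq_op 0) (runs c (nseq k d)).
Proof. by move=> Hd; elim: k => [|k IH] //=; rewrite (negbTE Hd). Qed.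

Lemma runs_le_size c w : all (fun k => k <= size w) (runs c w).
Proof.
elim: w => [|d w IH] //=.
have IH' : all (fun k => k <= (size w).+1) (runs c w).
  by apply: sub_all IH => k; exact: leqW.
case: ifP => _ //=.
by move: IH IH'; case: (runs c w) => [|k s] //= /andP[Hk _] /andP[_ ->]; rewrite ltnS Hk.
Qed.

Lemma mem_runs c d e u v k : d != c -> e != c ->
  k \in runs c (u ++ d :: nseq k c ++ e :: v).
Proof.
by move=> Hd He; rewrite !runs_cat // runs_nseq mem_cat /= inE eqxx orbT.
Qed.

(** No run crosses the letter [d] opening each copy; in the induction [v] becomes the tail of the
    preceding copy. *)
Lemma all_runs_wpow (p : pred nat) c d u v k : d != c ->
  all p (runs c u) -> all p (runs c v) ->
  all p (runs c (v ++ wpow k (d :: u))).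
Proof.
move=> Hd Hu; elim: k v => [|k IH] v Hv; first by rewrite cats0.
by rewrite /wpow /= runs_cat // all_cat Hv; exact: IH.
Qed.

End Runs.

(** * Reduced words containing all reduced pairs of letters *)

Section FullWord.
Variable n : nat.
Hypothesis n_ge2 : 2 <= n.

(** Only two of the at least four letters are excluded. *)
Lemma compat_between (x y : letter n) : exists2 c, compat x c & compat c y.
Proof.
have : 0 < #|[predC pred2 (linv x) (linv y)]|.
  rewrite -(ltn_add2l #|pred2 (linv x) (linv y)|) addn0 cardC.
  rewrite card2 card_prod card_ord card_bool.
  by case: (linv x != linv y) => /=; lia.
case/card_gt0P => c; rewrite !inE negb_or => /andP[Hx Hy].
exists c => //; rewrite /compat; apply: contraNneq Hy => ->.
by rewrite linvK.
Qed.

(** Each pair is appended with connecting letters on both sides; keeping [b] at both ends lets the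
    construction continue. *)
Lemma word_with_pairs (b : letter n) (r : seq (letter n * letter n)) :
  all (fun q => compat q.1 q.2) r ->
  exists V, sorted (@compat n) (b :: rcons V b) /\
    all (fun q => infix [:: q.1; q.2] (b :: rcons V b)) r.
Proof.
elim: r => [|[x y] r IH]; first by exists [::]; rewrite /= compat_refl.
case/andP=> /= Hxy /IH[V [Hs Hr]].
have [c Hbc Hcx] := compat_between b x; have [d Hyd Hdb] := compat_between y b.
exists (rcons V b ++ [:: c; x; y; d]); split.
  rewrite rcons_cat /= cat_path last_rcons; move: Hs => /= -> /=.
  by rewrite Hbc Hcx Hxy Hyd Hdb.
apply/andP; split.
  change (infix [:: x; y] (b :: rcons (rcons V b ++ [:: c; x; y; d]) b)).
  apply/infixP; exists (b :: rcons V b ++ [:: c]), [:: d; b].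
  by rewrite rcons_cat /= -catA.
have Hin : infix (b :: rcons V b) (b :: rcons (rcons V b ++ [:: c; x; y; d]) b).
  by rewrite rcons_cat -cat_cons; exact: prefix_infix.
by apply: sub_all Hr => q Hq; exact: (infix_trans Hq Hin).
Qed.

Lemma full_word (b : letter n) : exists V, sorted (@compat n) (b :: rcons V b) /\
  forall x y : letter n, x != y -> infix [:: linv x; y] (b :: rcons V b).
Proof.
have [V [Hs /allP Hr]] := word_with_pairs b
  (filter_all (fun q => compat q.1 q.2) (enum {: letter n * letter n})).
exists V; split=> // x y Hxy.
apply: (Hr (linv x, y)); rewrite mem_filter mem_enum andbT /compat /= linvK.
by rewrite eq_sym.
Qed.

End FullWord.

(** * Blocks, markers and their counts *)

Section Blocks.
Variables (n : nat) (a b : letter n) (V : seq (letter n)).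

(** Longer than any run inside [V], and different for different [j]. *)
Definition run_length j := (size V).+1 + j.
Definition block j := b :: V ++ b :: nseq (run_length j) a.
(** The final [b] closes the last run of [a], so that an occurrence determines the exact length of
    that run. *)
Definition marker j := block j ++ [:: b].

Lemma size_block j : size (block j) = (size V).*2.+3 + j.
Proof. by rewrite /= size_cat /= size_nseq /run_length; lia. Qed.

Lemma size_marker j : size (marker j) = (size V).*2.+4 + j.
Proof. by rewrite size_cat size_block /=; lia. Qed.

Hypothesis ab_distinct : a.1 != b.1.

Lemma linv_neq_b : linv a != b.
Proof. by apply: contraNneq ab_distinct => <-. Qed.

Lemma b_neq_a : b != a.
Proof. by apply: contraNneq ab_distinct => ->. Qed.

Lemma runs_V_lt c i : all (fun t => t < run_length i) (runs c V).
Proof.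
by apply: sub_all (runs_le_size c V) => t; rewrite /run_length; lia.
Qed.

(** In powers of [block j] a run of [a] is either too short, lying in [V], or of length
    [run_length j]; the marker needs [run_length i]. *)
Lemma marker_notin_wpow i j k : i != j -> ~~ infix (marker i) (wpow k (block j)).
Proof.
move=> Hij; apply/negP => /infixP[s1 [s2 E]].
pose p t := (t < run_length 0) || (t == run_length j).
have Hp : all p (runs a (wpow k (block j))).
  apply: (@all_runs_wpow _ p a b _ [::]); rewrite ?b_neq_a //.
  rewrite runs_cat ?b_neq_a // all_cat runs_nseq /= {2}/p eqxx orbT andbT.
  have Hsub : subpred (fun t => t < run_length 0) p by move=> t; rewrite /p => ->.
  by rewrite (sub_all Hsub (runs_V_lt a 0)).
have /(allP Hp) : run_length i \in runs a (wpow k (block j)).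
  have -> : wpow k (block j) =
      (s1 ++ b :: V) ++ b :: nseq (run_length i) a ++ b :: s2.
    by rewrite E /marker /block -!catA /= -!catA.
  by apply: mem_runs; rewrite b_neq_a.
rewrite /p /run_length; lia.
Qed.

(** After inversion, a long run of [linv a] would have to occur in a positive power, where [linv a]
    occurs only inside [V]. *)
Lemma marker_notin_finv_wpow i j k : ~~ infix (marker i) (finv (wpow k (block j))).
Proof.
apply/negP => /infixP[s1 [s2 /(congr1 (@Defs.finv n))]]; rewrite finvK => E.
pose p t := t < run_length 0.
have Hba : b != linv a by rewrite eq_sym linv_neq_b.
have Hp : all p (runs (linv a) (wpow k (block j))).
  apply: (@all_runs_wpow _ p (linv a) b _ [::]) => //.
  rewrite runs_cat // all_cat runs_V_lt /=.
  have Ha : a != linv a by exact: compat_refl.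
  by apply: sub_all (runs_nseq_neq (run_length j) Ha) => t /eqP <-.
have /(allP Hp) : run_length i \in runs (linv a) (wpow k (block j)).
  have -> : wpow k (block j) = finv s2 ++
      linv b :: nseq (run_length i) (linv a) ++ linv b :: finv (b :: V) ++ finv s1.
    have finvN k' : finv (nseq k' a) = nseq k' (linv a) by rewrite /Defs.finv map_nseq rev_nseq.
    rewrite E /marker /block -cat_cons !finv_cat (finv_cons b (nseq _ _)) finvN.
    by rewrite -!catA cat_rcons.
  by apply: mem_runs; rewrite (inj_eq (@linv_inj n)) b_neq_a.
rewrite /p /run_length; lia.
Qed.

Definition block_count i k := occ (marker i) (wpow k (block i)).

Lemma block_countD i k l : block_count i k + block_count i l <= block_count i (k + l).
Proof. by rewrite /block_count wpowD occ_cat_ge. Qed.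

(** Each copy except the last is followed by the [b] that completes a marker, hence the loss of
    one. *)
Lemma block_count_ge i k : k <= (block_count i k).+1.
Proof.
elim: k => [|[|k] IH] //; apply: leq_ltn_trans IH _; rewrite ltnS.
rewrite /block_count; set w := wpow k.+1 (block i).
have -> : wpow k.+2 (block i) = block i ++ w by [].
have Hp : prefix (marker i) (block i ++ w).
  apply/prefixP; exists (behead (block i) ++ wpow k (block i)).
  by rewrite /marker -catA.
change (occ (marker i) (block i ++ w)) with
  (prefix (marker i) (block i ++ w) + occ (marker i) (behead (block i) ++ w)).
rewrite Hp; apply: leq_trans (occ_cat_ge _ _ _); exact: leq_addl.
Qed.

Lemma brooks_wpow_block i k : brooks (marker i) (wpow k (block i)) = Z.of_nat (block_count i k).
Proof.
by rewrite /brooks (occ_eq0 (marker_notin_finv_wpow _ _ _)) Z.sub_0_r.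
Qed.

Lemma brooks_zpow_block_neq i j s : i != j -> brooks (marker i) (zpow (block j) s) = 0%Z.
Proof.
move=> Hij.
have H k : brooks (marker i) (wpow k (block j)) = 0%Z.
  by rewrite /brooks !occ_eq0 ?marker_notin_finv_wpow ?marker_notin_wpow.
by rewrite /zpow -finv_wpow; case: ifP => _; rewrite ?brooks_finv H.
Qed.

(** The count is superadditive and loses at most one per power; opposite signs involve two powers,
    whence the 2. *)
Lemma brooks_zpow_block_dist i s s' : (Z.abs (s - s') - 2 <=
  Z.abs (brooks (marker i) (zpow (block i) s) - brooks (marker i) (zpow (block i) s')))%Z.
Proof.
have mono k l : k <= l ->
    l - k <= (block_count i l - block_count i k).+1 /\ block_count i k <= block_count i l.
  move=> Hkl; have := block_countD i (l - k) k; have := block_count_ge i (l - k).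
  by rewrite subnK //; lia.
rewrite /zpow -!finv_wpow.
have := block_count_ge i (Z.abs_nat s); have := block_count_ge i (Z.abs_nat s').
have := @mono (Z.abs_nat s) (Z.abs_nat s'); have := @mono (Z.abs_nat s') (Z.abs_nat s).
by case: Z.leb_spec => Hs; case: Z.leb_spec => Hs'; rewrite ?brooks_finv !brooks_wpow_block; lia.
Qed.

Hypothesis V_sorted : sorted (@compat n) (b :: rcons V b).

Lemma cycle_block j : cycle (@compat n) (block j).
Proof.
have Hba : compat b a.
  by rewrite /compat; apply: contraNneq ab_distinct => ->.
have Hab : compat a b by rewrite /compat eq_sym linv_neq_b.
have tail k c : compat c a -> compat c b -> path (@compat n) c (rcons (nseq k a) b).
  by elim: k c => [|k IH] c Hca Hcb /=; rewrite ?Hcb // Hca IH // compat_refl.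
change (path (@compat n) b (rcons (V ++ b :: nseq (run_length j) a) b)).
rewrite -cat_rcons rcons_cat cat_path last_rcons tail ?compat_refl // andbT.
exact: V_sorted.
Qed.

Lemma wpow_block_sorted j k : sorted (@compat n) (wpow k (block j)).
Proof.
have [|H _] := path_wpow (z := last b (block j)) k (cycle_block j).
  by rewrite /block.
exact: path_sorted H.
Qed.

Lemma zpow_block_sorted j s : sorted (@compat n) (zpow (block j) s).
Proof.
by rewrite /zpow -finv_wpow; case: ifP => _; rewrite ?sorted_finv wpow_block_sorted.
Qed.

(** Factors with [j != i] contribute 0, and each multiplication costs three marker lengths for [x]
    and three for [y]. *)
Lemma brooks_zprod (m : nat) (i : 'I_m) (r : seq 'I_m) (x y : 'I_m -> Z) : uniq r ->
  let B z := brooks (marker i) (reduce (zprod (fun j : 'I_m => block j) r z)) in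
  let P z := brooks (marker i) (zpow (block i) (z i)) in
  (Z.abs (B x - B y - (if i \in r then P x - P y else 0))
     <= 6 * Z.of_nat (size (marker i)) * Z.of_nat (size r))%Z.
Proof.
move=> Hu B P; rewrite {}/B.
elim: r Hu => [|j r IH]; first by rewrite /zprod /= /brooks /=; lia.
rewrite [uniq _]/= => /andP[Hj /IH {}IH].
have step z : (Z.abs (brooks (marker i) (reduce (zprod (fun j : 'I_m => block j) (j :: r) z))
    - brooks (marker i) (zpow (block j) (z j))
    - brooks (marker i) (reduce (zprod (fun j : 'I_m => block j) r z)))
    <= 3 * Z.of_nat (size (marker i)))%Z.
  have := brooks_mul (T := marker i) (zpow_block_sorted j (z j))
    (reduce_sorted (zprod (fun j : 'I_m => block j) r z)).
  by rewrite reduce_catr.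
have -> : Z.of_nat (size (j :: r)) = (Z.of_nat (size r) + 1)%Z by exact: Nat2Z.inj_succ.
rewrite Z.mul_add_distr_l.
have := step x; have := step y; move: IH; rewrite inE; case: eqP => [E|/eqP Hij].
  by rewrite E (negbTE Hj) /= /P -E; lia.
have Hij' : val i != val j by [].
by rewrite !(brooks_zpow_block_neq _ Hij') /=; lia.
Qed.

End Blocks.

(** * The quasi-isometry constants and the embedding *)

Lemma qi_inequality (l k L E : nat) : 0 < L -> l <= E + L * k ->
  Rle (Rminus (Rdiv (INR l) (INR L)) (INR E)) (INR k).
Proof.
move=> HL Hl.
have HL' : Rle 1 (INR L) by apply: (le_INR 1); apply/leP.
have : Rle (INR l) (INR (L * (E + k))) by apply: le_INR; apply/leP; nia.
rewrite mult_INR plus_INR => H.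
suff : Rle (Rdiv (INR l) (INR L)) (Rplus (INR E) (INR k)) by lra.
apply: (Rmult_le_reg_l (INR L)); first by lra.
have -> : Rmult (INR L) (Rdiv (INR l) (INR L)) = INR l by field; lra.
exact: H.
Qed.

Lemma INR_affine (l k E : nat) :
  INR (l * k + E) = Rplus (Rmult (INR l) (INR k)) (INR E).
Proof. by rewrite plus_INR mult_INR. Qed.

Theorem mainTheorem9 (n : nat) (hn : 2 <= n) (m : nat) :
  qi_embeds_Zm_whitehead n m.
Proof.
have n_gt0 : 0 < n by lia.
pose a : letter n := (Ordinal n_gt0, false); pose b : letter n := (Ordinal hn, false).
have Hab : a.1 != b.1 by [].
have [V [HVs HVf]] := full_word hn b.
pose W (j : 'I_m) := block a b V j; pose T (j : 'I_m) := marker a b V j.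
have Tfull i (x y : letter n) : x != y -> infix [:: linv x; y] (T i).
  move=> /HVf Hi; apply: (infix_trans Hi).
  have -> : T i = (b :: rcons V b) ++ nseq (run_length V i) a ++ [:: b].
    by rewrite /T /marker /block /= cat_rcons -catA.
  exact: prefix_infix.
(* [D] bounds the lengths of all [T i] and [W j], the indices being below [m]. *)
pose D := size (marker a b V m).
pose r := index_enum 'I_m.
exists (fun x => reduce (zprod W r x)); split; first by move=> x; exact: reduced_reduce.
(* The [m] coordinate estimates add up to the slope [m * (17 * D)] and the error [E]; the extra [D]
   serves the upper bound. *)
pose L := (m * (17 * D) + D).+1; pose E := m * (6 * D * size r + 2).
exists (INR L), (INR E); split; first by apply: (le_INR 1); apply/leP.
split; first exact: pos_INR.
move=> x y; split.
- move=> p Hp; apply: qi_inequality => //.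
  (* The quasimorphism of [T i] recovers the [i]-th coordinate up to a bounded error and varies by
     at most [17 * D] per edge. *)
  have coord i : Z.abs_nat (x i - y i) <= 6 * D * size r + 2 + 17 * D * size p.
    have Hw := brooks_walk (Tfull i) (reduced_reduce _) Hp.
    have Hprod : (Z.abs (brooks (T i) (reduce (zprod W r x)) - brooks (T i) (reduce (zprod W r y))
        - (brooks (T i) (zpow (W i) (x i)) - brooks (T i) (zpow (W i) (y i))))
        <= 6 * Z.of_nat (size (T i)) * Z.of_nat (size r))%Z.
      have := brooks_zprod (i := i) (x := x) (y := y) Hab HVs (index_enum_uniq 'I_m).
      by rewrite mem_index_enum.
    have := @brooks_zpow_block_dist n a b V Hab i (x i) (y i); rewrite -/(T i) -/(W i).
    have HT : size (T i) <= D by rewrite /T /D !size_marker leq_add2l ltnW.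
    have HTr : size (T i) * size r <= D * size r by rewrite leq_mul2r HT orbT.
    have HTp : size (T i) * size p <= D * size p by rewrite leq_mul2r HT orbT.
    move: Hw Hprod HTr HTp; rewrite -!mulnA -!Z.mul_assoc -!Nat2Z.inj_mul.
    by lia.
  rewrite /l1dist; apply: leq_trans (leq_sum _ (fun i _ => coord i)) _.
  by rewrite sum_nat_const card_ord /E /L; nia.
- have HM j : size (W j) <= D by rewrite /W /D size_block size_marker; have := ltn_ord j; lia.
  have := reach_zprod hn r x y [::] [::] HM; rewrite !cats0 => -[p Hp Hs].
  exists p; split; first exact: Hp.
  rewrite -INR_affine.
  apply: le_INR; apply/leP; apply: leq_trans Hs _; rewrite /l1dist -/r.
  by apply: leq_trans (leq_addr _ _); rewrite leq_mul // /L; lia.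
Qed.
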